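(* There exists a minimal dynamical system $(Y,S)$ which is weakly mixing (hence in particular does not have distal points), yet has the property that for every minimal dynamical system $(X,T)$ every pair $(y,x)\in Y\times X$ is a recurrent point of the product system $(Y\times X,\,S\times T)$. Here the absence of distal points is part of the assertion: no point of $Y$ is a distal point.
   Context: A dynamical system is a pair $(X,T)$ where $X$ is a nonempty compact metric space and $T:X\to X$ is a homeomorphism. The system is minimal if every orbit $\{T^n x: n\in\mathbb{Z}\}$ is dense in $X$. It is weakly mixing if the product system $(X\times X,T\times T)$ is topologically transitive, i.e. for all nonempty open $U,V\subset X\times X$ there is $n\in\mathbb{Z}$ with $(T\times T)^n U\cap V\neq\emptyset$. Two points $x,x'\in X$ are proximal if there is a sequence of positive integers $n_k$ with $d(T^{n_k}x,T^{n_k}x')\to 0$, where $d$ is the metric on $X$. A point $x\in X$ is distal if it is proximal only to itself. A point $z$ of a dynamical system $(Z,R)$ is recurrent if for every neighborhood $V$ of $z$ there is an integer $n\geq 1$ with $R^{n}z\in V$; equivalently, there is a sequence of positive integers $n_k\to\infty$ with $R^{n_k}z\to z$. *)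

(* Defs.v *)
From HB Require Import structures.
From mathcomp Require Import all_boot all_order all_algebra.
From mathcomp Require Import all_classical all_reals all_analysis.
Set Implicit Arguments.
Unset Strict Implicit.
Unset Printing Implicit Defensive.
Import Order.TTheory GRing.Theory Num.Theory.
Import numFieldNormedType.Exports.
Local Open Scope classical_set_scope.
Local Open Scope ring_scope.

Record homeo (X : topologicalType) := Homeo {
  homeo_fun :> X -> X;
  homeo_inv : X -> X;
  homeo_funK : cancel homeo_fun homeo_inv;
  homeo_invK : cancel homeo_inv homeo_fun;
  homeo_fun_continuous : continuous homeo_fun;
  homeo_inv_continuous : continuous homeo_inv
}.

(* [Negz k] is the integer - (k + 1). *)
Definition iterz (X : topologicalType) (T : homeo X) (n : int) : X -> X :=
  match n with
  | Posz k => iter k T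
  | Negz k => iter k.+1 (homeo_inv T)
  end.

Definition prod_map (X Y : Type) (f : X -> X) (g : Y -> Y) (z : X * Y) : X * Y :=
  (f z.1, g z.2).

Lemma prod_map_continuous (X Y : topologicalType) (f : X -> X) (g : Y -> Y) :
  continuous f -> continuous g -> continuous (prod_map f g).
Proof.
move=> cf cg z; apply: cvg_pair => /=.
- by apply: (cvg_comp fst f); [exact: cvg_fst | exact: cf].
- by apply: (cvg_comp snd g); [exact: cvg_snd | exact: cg].
Qed.

Lemma prod_mapK (X Y : Type) (f f' : X -> X) (g g' : Y -> Y) :
  cancel f f' -> cancel g g' -> cancel (prod_map f g) (prod_map f' g').
Proof. by move=> fK gK [x y]; rewrite /prod_map /= fK gK. Qed.

Definition prod_homeo (X Y : topologicalType) (S : homeo X) (T : homeo Y) :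
    homeo (X * Y)%type :=
  Homeo (prod_mapK (@homeo_funK _ S) (@homeo_funK _ T))
        (prod_mapK (@homeo_invK _ S) (@homeo_invK _ T))
        (prod_map_continuous (@homeo_fun_continuous _ S)
                             (@homeo_fun_continuous _ T))
        (prod_map_continuous (@homeo_inv_continuous _ S)
                             (@homeo_inv_continuous _ T)).

Definition topologically_transitive (X : topologicalType) (T : homeo X) : Prop :=
  forall U V : set X, open U -> U !=set0 -> open V -> V !=set0 ->
    exists n : int, (iterz T n @` U) `&` V !=set0.

Definition recurrent (Z : topologicalType) (T : homeo Z) (z : Z) : Prop :=
  forall V : set Z, nbhs z V -> exists2 n : nat, (1 <= n)%N & V (iter n T z).

Record dynsys (R : realType) := DynSys {
  dynsys_space :> metricType R;
  dynsys_map : homeo dynsys_space;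
  dynsys_nonempty : [set: dynsys_space] !=set0;
  dynsys_compact : compact [set: dynsys_space]
}.

Definition minimal (R : realType) (X : dynsys R) : Prop :=
  forall x : X, dense (range (fun n : int => iterz (dynsys_map X) n x)).

Definition weakly_mixing (R : realType) (X : dynsys R) : Prop :=
  topologically_transitive (prod_homeo (dynsys_map X) (dynsys_map X)).

Definition proximal (R : realType) (X : dynsys R) (x x' : X) : Prop :=
  exists n_ : nat -> nat, (forall k, 0 < n_ k)%N /\
    mdist (iter (n_ k) (dynsys_map X) x) (iter (n_ k) (dynsys_map X) x')
      @[k --> \oo] --> (0 : R).

Definition distal_point (R : realType) (X : dynsys R) (x : X) : Prop :=
  forall x' : X, proximal x x' -> x' = x.

(* Main.v *)
(* The system is a time change of the linear flow on the 4-adic solenoid,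
whose points are the sequences (x_i) in R/Z with 4 x_{i+1} = x_i.  Moving x to
(x_i + s/4^i) takes the time
  clock s x = s + sum_i 2^(i-2) (|x_i + s/4^i| - |x_i|),
where |.| is the distance to the nearest integer: the i-th summand is a triangle
wave of period 4^i and slope 2^-(i+2).  These amplitudes are unbounded, and this
forces the drift between two points of distinct leaves (flow orbits) to be
unbounded in forward time.  Indeed second differences of the clocks with step
4^i/2 isolate the i-th wave, so that a bounded drift bounds 2^i |y_i - x_i|, and
then y - x is a real number.

At precision J any offset y - x is a real number, and the relative time shift of
the two orbits then changes by O(2^-J) per unit of time.  Since it is unbounded,
it is close to every s >= 0 (or every s <= 0) at some time: the orbit of (x, y)
accumulates on the graph of phi s for all s of one sign.

Let now (y, x) be a point of the product with a minimal system, W its forward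
orbit closure, M a minimal subset of W, and (y', x) a point of M.  If y = phi s y'
then W is the image of M under phi s.  Otherwise the preceding property shows
that the image of M under phi s meets W, hence lies in W, for all s of one sign;
half leaves are dense, so W contains (y, x).  Minimality and weak mixing follow
from the same property. *)
Require Import Defs.
From HB Require Import structures.
From mathcomp Require Import all_boot all_order all_algebra.
From mathcomp Require Import all_classical all_reals all_analysis.
From mathcomp Require Import ring lra zify.
Set Implicit Arguments.
Unset Strict Implicit.
Unset Printing Implicit Defensive.
Import Order.TTheory GRing.Theory Num.Theory.
Import numFieldNormedType.Exports.
Local Open Scope classical_set_scope.
Local Open Scope ring_scope.

(** * The triangle wave given by the distance to the integers *)

Section DistanceToIntegers.
Context {R : realType}.
Implicit Types (x y : R) (k l m : int).

(** The distance from [x] to the nearest integer, hence a triangle wave of period 1. *)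
Definition tri x : R :=
  Num.min (x - (Num.floor x)%:~R) (1 - (x - (Num.floor x)%:~R)).

Lemma floor_fracP x : 0 <= x - (Num.floor x)%:~R < 1.
Proof. by have /andP[h0 h1] := floor_itv x; rewrite intrD in h1; lra. Qed.

Lemma tri_leint x k : tri x <= `|x - k%:~R|.
Proof.
have /andP[h0 h1] := floor_fracP x; rewrite /tri.
set r := x - _ in h0 h1 *; have [kf|kf] := leP k (Num.floor x).
- have : (k%:~R : R) <= (Num.floor x)%:~R by rewrite ler_int.
  move=> kf'; rewrite ge_min; apply/orP; left.
  by rewrite ger0_norm; rewrite /r in h0 *; lra.
- have : ((Num.floor x)%:~R + 1 : R) <= k%:~R.
    by rewrite -[1]/(1%:~R) -intrD ler_int lezD1.
  move=> kf'; rewrite ge_min; apply/orP; right.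
  by rewrite ler0_norm; rewrite /r in h1 *; lra.
Qed.

Lemma tri_int x : exists2 k, tri x = `|x - k%:~R| & `|x - k%:~R| <= 1 / 2.
Proof.
have /andP[h0 h1] := floor_fracP x; rewrite /tri.
have [h|h] := leP (x - (Num.floor x)%:~R) (1 - (x - (Num.floor x)%:~R)).
  by exists (Num.floor x); rewrite ger0_norm//; lra.
by exists (Num.floor x + 1); rewrite intrD ler0_norm ?mulr1z; lra.
Qed.

Lemma tri_ge0 x : 0 <= tri x.
Proof. by have [k -> _] := tri_int x. Qed.

Lemma tri_le_half x : tri x <= 1 / 2.
Proof. by have [k -> ] := tri_int x. Qed.

Lemma tri_le_norm x : tri x <= `|x|.
Proof. by have := tri_leint x 0; rewrite subr0. Qed.

Lemma triD x y : tri (x + y) <= tri x + tri y.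
Proof.
have [k -> _] := tri_int x; have [l -> _] := tri_int y.
apply: le_trans (tri_leint _ (k + l)) _.
by rewrite intrD opprD addrACA ler_normD.
Qed.

Lemma triN x : tri (- x) = tri x.
Proof.
suff le_triN y : tri (- y) <= tri y.
  by apply/eqP; rewrite eq_le le_triN -{1}[x]opprK le_triN.
have [k -> _] := tri_int y; apply: le_trans (tri_leint _ (- k)) _.
by rewrite intrN -opprD normrN.
Qed.

Lemma triBC x y : tri (x - y) = tri (y - x).
Proof. by rewrite -triN opprB. Qed.

Lemma tri_eq0 x : (tri x == 0) = (x \is a Num.int).
Proof.
apply/idP/intrP => [|[k ->]].
  by have [k -> _] := tri_int x; rewrite normr_eq0 subr_eq0 => /eqP; exists k.
by rewrite eq_le tri_ge0 andbT -[leRHS](@normr0 _ R) -(subrr (k%:~R)) tri_leint.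
Qed.

Lemma tri_congr x y : x - y \is a Num.int -> tri x = tri y.
Proof.
rewrite -tri_eq0 => /eqP xy; apply/eqP; rewrite eq_le; apply/andP; split.
  by rewrite -[x](subrK y) (le_trans (triD _ _))// xy add0r.
by rewrite -[y](subrK x) (le_trans (triD _ _))// triBC xy add0r.
Qed.

Lemma tri_lip x y : `|tri x - tri y| <= tri (x - y).
Proof.
rewrite ler_norml; have := triD (x - y) y; have := triD (y - x) x.
by rewrite !subrK triBC; move: (tri x) (tri y) (tri (x - y)) => a b c; lra.
Qed.

Lemma tri_lip_norm x y : `|tri x - tri y| <= `|x - y|.
Proof. exact: le_trans (tri_lip _ _) (tri_le_norm _). Qed.

Lemma tri_small x : `|x| <= 1 / 2 -> tri x = `|x|.
Proof.
move=> hx; apply/eqP; rewrite eq_le tri_le_norm /=.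
have [k -> _] := tri_int x.
have [->|k0] := eqVneq k 0; first by rewrite subr0.
have : (1 : R) <= `|k%:~R| by rewrite -intr_norm -[1]/(1%:~R) ler_int -gtz0_ge1 normr_gt0.
have := lerB_normD (k%:~R) (- x); rewrite normrN distrC.
by move: (`|x|) (`|k%:~R|) hx (`|x - k%:~R|) => a b ha c; lra.
Qed.

(** The cells are the maximal intervals on which [tri] is affine. *)
Definition in_cell l x := (l%:~R / 2 <= x <= (l%:~R + 1) / 2 : bool).

Lemma tri_cell l x : in_cell l x ->
  tri x = if (2 %| l)%Z then x - l%:~R / 2 else (l%:~R + 1) / 2 - x.
Proof.
move=> /andP[h0 h1]; case: ifPn => [/dvdzP[q ql]|].
  rewrite ql in h0 h1 *; rewrite intrM in h0 h1 *.
  rewrite (@tri_congr _ (x - q%:~R)); last by rewrite opprB addrC subrK intr_int.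
  by rewrite tri_small ger0_norm; lra.
move=> /dvdz_mod0P nl; have [q ql] : exists q, l = q * 2 + 1.
  exists (l %/ 2)%Z; rewrite {1}(divz_eq l 2); congr (_ + _).
  have := modz_ge0 l (isT : (2 : int) != 0).
  have := ltz_pmod l (isT : (0 < 2 :> int)).
  by move: nl; case: (l %% 2)%Z => [[|[|]]|].
rewrite ql in h0 h1 *; rewrite intrD intrM in h0 h1 *.
rewrite (@tri_congr _ (x - (q + 1)%:~R)); last by rewrite opprB addrC subrK intr_int.
by rewrite intrD in h0 h1 *; rewrite tri_small ler0_norm; lra.
Qed.

Lemma tri_midpoint l x e : in_cell l x -> in_cell l (x + e * 2) -> 0 <= e ->
  tri (x + e * 2) - 2 * tri (x + e) + tri x = 0.
Proof.
move=> h0 h1 e0; have h2 : in_cell l (x + e).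
  by move: h0 h1; rewrite /in_cell => /andP[? ?] /andP[? ?]; lra.
by rewrite (tri_cell h0) (tri_cell h1) (tri_cell h2); case: ifP => _; lra.
Qed.

Lemma tri_half x : tri (x + 1 / 2) = 1 / 2 - tri x.
Proof.
have [k -> ] := tri_int x; rewrite (@tri_congr _ (x - k%:~R + 1 / 2)); last first.
  by rewrite opprD opprB addrACA subrr addr0 addrC subrK intr_int.
move: (x - _) => r; rewrite ler_norml => /andP[h0 h1].
have [r0|r0] := leP 0 r; last by rewrite (ltr0_norm r0) tri_small ger0_norm; lra.
rewrite (ger0_norm r0) (@tri_congr _ (r - 1 / 2)).
  by rewrite tri_small ler0_norm; lra.
by rewrite opprB addrC addrA subrK -splitr rpred1.
Qed.

End DistanceToIntegers.

(** * The 4-adic solenoid as a compact metric space *)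

Section Solenoid.
Context {R : realType}.
Implicit Types (f g : nat -> R).

Definition compat f := forall i, 4 * f i.+1 - f i \is a Num.int.

(** Taking the representatives in [0, 1) of the coordinates in R/Z makes a point determined by its
    real sequence. *)
Definition solenoid := {f : nat -> R | compat f /\ forall i, 0 <= f i < 1}.

HB.instance Definition _ := gen_eqMixin solenoid.
HB.instance Definition _ := gen_choiceMixin solenoid.

Definition coord (x : solenoid) : nat -> R := sval x.
Coercion coord : solenoid >-> Funclass.

Lemma coordP (x : solenoid) : compat x.
Proof. by case: x => f []. Qed.

Lemma coord_itv (x : solenoid) i : 0 <= x i < 1.
Proof. by case: x => f []. Qed.

Lemma int_small (a : R) : a \is a Num.int -> `|a| < 1 -> a = 0.
Proof.
move=> /intrP[k ->]; rewrite -intr_norm -[1]/(1%:~R) ltr_int => k1.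
by have -> : k = 0 by move: k1; case: k => [[|]|].
Qed.

Lemma solenoidP (x y : solenoid) : (forall i, x i - y i \is a Num.int) -> x = y.
Proof.
move=> xy; have xyE : coord x = coord y.
  apply/funext => i; apply/eqP; rewrite -subr_eq0; apply/eqP.
  apply: int_small; first exact: xy.
  have /andP[? ?] := coord_itv x i; have /andP[? ?] := coord_itv y i.
  by rewrite ltr_norml; lra.
by move: x y {xy} xyE => [f fP] [g gP]; rewrite /coord/= => fg; exact: eq_exist.
Qed.

Lemma compat0 : compat (fun=> 0).
Proof. by move=> i; rewrite mulr0 subr0 rpred0. Qed.

Lemma compatD f g : compat f -> compat g -> compat (fun i => f i + g i).
Proof. by move=> cf cg i; rewrite mulrDr opprD addrACA rpredD. Qed.

Lemma compat_real (s : R) : compat (fun i => s / 4 ^+ i).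
Proof.
move=> i; rewrite (_ : 4 * _ - _ = 0) ?rpred0// exprS.
by field; rewrite expf_neq0// pnatr_eq0.
Qed.

Lemma compat_exp f i k : compat f -> 4 ^+ k * f (i + k)%N - f i \is a Num.int.
Proof.
move=> cf; elim: k => [|k IH]; first by rewrite addn0 mul1r subrr rpred0.
rewrite -(subrK (4 ^+ k * f (i + k)%N) (_ * _)) -addrA rpredD// addnS.
by rewrite exprSr -mulrA -mulrBr rpredM ?rpredX// natr_int.
Qed.

Lemma compat_le f i j : compat f -> (i <= j)%N ->
  f j \is a Num.int -> f i \is a Num.int.
Proof.
move=> cf /subnKC <- fj; have := compat_exp i (j - i) cf.
move=> /(rpredB (rpredM (rpredX (j - i) (natr_int R 4)) fj)).
by rewrite opprB addrC subrK.
Qed.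

Lemma compatN f : compat f -> compat (fun i => - f i).
Proof. by move=> cf i; rewrite mulrN -opprD rpredN. Qed.

Lemma frac_solenoid f : compat f ->
  compat (fun i => f i - (Num.floor (f i))%:~R) /\
  forall i, 0 <= f i - (Num.floor (f i))%:~R < 1.
Proof.
move=> cf; split=> i; last exact: floor_fracP.
rewrite (_ : 4 * _ - _ = (4 * f i.+1 - f i)
  - (4 * (Num.floor (f i.+1))%:~R - (Num.floor (f i))%:~R)); last by ring.
by rewrite rpredB// rpredB// ?rpredM ?intr_int// natr_int.
Qed.

(* [mk f] is a junk point when [f] is not compatible. *)
Definition mk f : solenoid :=
  match pselect (compat f) with
  | left cf => exist _ _ (frac_solenoid cf)
  | right _ => exist _ _ (frac_solenoid compat0)
  end.

Lemma mkE f i : compat f -> mk f i - f i \is a Num.int.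
Proof.
move=> cf; rewrite /mk; case: pselect => [{}cf|//]; rewrite /coord /=.
by rewrite addrAC subrr add0r rpredN intr_int.
Qed.

Implicit Types (x y z : solenoid).

Lemma exp2_large (C : R) : exists J, forall i, (J <= i)%N -> C < 2 ^+ i.
Proof. by exists (Num.bound C) => i; exact: upper_nthrootP. Qed.

(** The weights 2^-i make late coordinates negligible, so this metrizes coordinatewise convergence
    in R/Z. *)
Definition sdist (x y : solenoid) : R :=
  sup (range (fun i => tri (x i - y i) / 2 ^+ i)).

Let exp2_gt0 i : 0 < 2 ^+ i :> R.
Proof. by rewrite exprn_gt0. Qed.

Lemma sdist_le x y e : (forall i, tri (x i - y i) <= e * 2 ^+ i) -> sdist x y <= e.
Proof.
move=> h; apply: ge_sup; first by exists (tri (x 0%N - y 0%N) / 2 ^+ 0); exists 0%N.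
by move=> _ [i _ <-]; rewrite ler_pdivrMr.
Qed.

Lemma sdist_ge x y i : tri (x i - y i) <= sdist x y * 2 ^+ i.
Proof.
rewrite -ler_pdivrMr//; apply: ub_le_sup; last by exists i.
exists 1 => _ [j _ <-]; rewrite ler_pdivrMr// mul1r.
by apply: le_trans (tri_le_half _) _; rewrite (@le_trans _ _ 1) ?exprn_ege1//; lra.
Qed.

Lemma sdist_ge0 x y : 0 <= sdist x y.
Proof. by have := sdist_ge x y 0; rewrite expr0 mulr1; apply: le_trans; exact: tri_ge0. Qed.

Lemma sdistxx x : sdist x x = 0.
Proof.
apply/eqP; rewrite eq_le sdist_ge0 andbT; apply: sdist_le => i.
by rewrite subrr mul0r (eqP (_ : tri 0 == 0)) ?tri_eq0 ?rpred0.
Qed.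

Lemma sdist_eq0 x y : sdist x y = 0 -> x = y.
Proof.
move=> xy; apply: solenoidP => i; rewrite -tri_eq0 eq_le tri_ge0 andbT.
by have := sdist_ge x y i; rewrite xy mul0r.
Qed.

Lemma sdistC x y : sdist x y = sdist y x.
Proof.
by rewrite /sdist (_ : (fun i => _) = fun i => tri (y i - x i) / 2 ^+ i)//;
  apply/funext => i; rewrite triBC.
Qed.

Lemma sdist_triangle y x z : sdist x z <= sdist x y + sdist y z.
Proof.
apply: sdist_le => i; rewrite mulrDl; have := sdist_ge x y i; have := sdist_ge y z i.
by have := triD (x i - y i) (y i - z i); rewrite subrKA; lra.
Qed.

HB.instance Definition _ :=
  @isMetric.Build R solenoid sdist sdistxx sdist_eq0 sdistC sdist_triangle.

(** Agreement modulo integers at stage [J] propagates down to every earlier stage, and the later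
    stages carry weights below 2^-J. *)
Lemma sdist_agree (x y : solenoid) J :
  x J - y J \is a Num.int -> sdist x y <= (2 ^+ J)^-1.
Proof.
move=> xyJ; apply: sdist_le => i; have [iJ|Ji] := leqP i J.
  rewrite (eqP (_ : tri _ == 0)) ?mulr_ge0 ?invr_ge0 ?exprn_ge0// tri_eq0.
  by apply: (compat_le (compatD (coordP x) (compatN (coordP y))) iJ).
apply: le_trans (tri_le_half _) _; rewrite [leRHS]mulrC ler_pdivlMr//.
apply: le_trans (_ : 1 * 2 ^+ J <= _); first by rewrite ler_wpM2r ?exprn_ge0//; lra.
by rewrite mul1r ler_eXn2l ?ltr1n// ltnW.
Qed.

Lemma solenoid_compact : compact [set: solenoid].
Proof.
rewrite compact_ultra => F FU _; pose c i (x : solenoid) : R := x i.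
(* Each real coordinate converges along the ultrafilter, by compactness of [0, 1]. The limit may
   equal 1, so the limit point is later normalized by [mk]. *)
have lim_ex i : exists l, forall e, 0 < e -> \forall x \near F, `|l - c i x| < e.
  have [|l [_ Fl]] := @segment_compact R 0 1 (c i @ F) _.
    change (F (c i @^-1` `[0, 1])); apply: filterE => x.
    have /andP[h0 h1] := coord_itv x i.
    by rewrite /= in_itv/= h0 ltW.
  exists l => e e0; have [//|FN] := in_ultra_setVsetC [set x | `|l - c i x| < e] FU.
  have [r []] := Fl (~` ball l e) (ball l e) FN (nbhsx_ballx _ _ e0).
  by [].
have [l Fl] := choice lim_ex.
have cl : compat l.
  move=> i; rewrite -tri_eq0 eq_le tri_ge0 andbT.
  apply/ler_addgt0Pr => e e0; rewrite add0r.
  have e5 : 0 < e / 5 by rewrite divr_gt0.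
  have [x [h0 h1]] := filter_ex (filterI (Fl i _ e5) (Fl i.+1 _ e5)).
  rewrite (@tri_congr _ _ ((4 * l i.+1 - l i) - (4 * c i.+1 x - c i x))).
    2: by rewrite opprB addrC subrK; exact: coordP.
  apply: le_trans (tri_le_norm _) _.
  by move: h0 h1; rewrite !ltr_norml ler_norml => /andP[? ?] /andP[? ?]; lra.
exists (mk l); split=> //; apply/cvg_ballP => e e0.
(* From stage [J] on, the bound [tri <= 1 / 2] already suffices; only finitely many coordinates need
   to be close. *)
have [J /(_ _ (leqnn J)) eJ] := exp2_large e^-1.
have Je : 1 / 2 < e / 2 * 2 ^+ J.
  by rewrite mulrAC ltr_pM2r// mulrC -ltr_pdivrMr// mul1r.
have nearl : \forall x \near F, forall i : 'I_J, `|l i - c i x| < e / 2.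
  by apply: filter_forall => i; apply: Fl; rewrite divr_gt0.
apply: filterS nearl => x xl; rewrite ballEmdist/=.
apply: le_lt_trans (_ : e / 2 < e); last by lra.
apply: sdist_le => i; rewrite (@tri_congr _ _ (l i - x i)); last first.
  by rewrite opprB addrA subrK; exact: mkE.
have [iJ|Ji] := ltnP i J; last first.
  apply: le_trans (tri_le_half _) _; apply: le_trans (ltW Je) _.
  by rewrite ler_wpM2l ?ler_eXn2l ?divr_ge0 ?ltr1n// ltW.
apply: le_trans (tri_le_norm _) _; apply: le_trans (ltW (xl (Ordinal iJ))) _.
by rewrite ler_peMr ?exprn_ege1 ?divr_ge0 ?ler1n// ltW.
Qed.

End Solenoid.

(** * Series dominated by a geometric series of ratio 1/2 *)

Section GeometricSeries.
Context {R : realType}.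
Implicit Types (u v : nat -> R) (C : R).

Definition geo C u := forall i, `|u i| <= C / 2 ^+ i.

Definition ssum u : R := limn (series u).

Lemma geo_is_cvg C u : geo C u -> cvgn (series u).
Proof.
move=> hu; apply: normed_cvg; apply: (series_le_cvg _ _ hu).
- by move=> i; exact: normr_ge0.
- by move=> i; apply: le_trans (hu i); exact: normr_ge0.
rewrite (_ : (fun i => C / 2 ^+ i) = geometric C (2^-1)); last first.
  by apply/funext => i; rewrite /geometric/= exprVn.
by apply: is_cvg_geometric_series; rewrite ger0_norm ?invr_ge0// invf_lt1// ltr1n.
Qed.

Lemma geoB C D u v : geo C u -> geo D v -> geo (C + D) (u \- v).
Proof. by move=> hu hv i; rewrite mulrDl (le_trans (ler_normB _ _))// lerD. Qed.

Lemma ssumB C D u v : geo C u -> geo D v -> ssum (u \- v) = ssum u - ssum v.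
Proof.
move=> /geo_is_cvg hu /geo_is_cvg hv; apply/cvg_lim => //.
rewrite (_ : series (u \- v) = series u \- series v); first exact: cvgB.
by apply/funext => n; rewrite /series/= sumrB.
Qed.

(** The terms from [J] on sum to at most C (2^-J + 2^-(J+1) + ...). *)
Lemma ssum_tail C u J : geo C u -> (forall i, (i < J)%N -> u i = 0) ->
  `|ssum u| <= 2 * C / 2 ^+ J.
Proof.
move=> hu u0; have C0 : 0 <= C.
  by have := hu 0%N; rewrite expr0 divr1; apply: le_trans; exact: normr_ge0.
have bound n : `|series u (J + n)%N| <= 2 * C / 2 ^+ J - 2 * C / 2 ^+ (J + n).
  elim: n => [|n IH].
    rewrite addn0 subrr /series/= big1_seq ?normr0// => i /=.
    by rewrite mem_index_iota => /andP[_]; exact: u0.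
  rewrite addnS seriesSr (le_trans (ler_normD _ _))//.
  apply: le_trans (lerD IH (hu _)) _; rewrite exprSr.
  have : 2 ^+ (J + n) != 0 :> R by rewrite expf_neq0.
  move: (2 ^+ (J + n)) (2 * C / 2 ^+ J) => p q p0.
  by rewrite le_eqVlt; apply/orP; left; apply/eqP; field.
have cu := geo_is_cvg hu; apply: (cvgr_to_le (cvg_norm cu)).
exists J => // n /= /subnKC <-; apply: le_trans (bound _) _.
by rewrite gerBl divr_ge0 ?mulr_ge0 ?exprn_ge0.
Qed.

Lemma ssum_le C u : geo C u -> `|ssum u| <= 2 * C.
Proof. by move=> hu; have := @ssum_tail C u 0 hu; rewrite expr0 divr1; apply. Qed.

Lemma ssum_single u J : (forall i, i <> J -> u i = 0) -> ssum u = u J.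
Proof.
move=> u0; apply/cvg_lim => //; apply: cvg_near_cst.
exists J.+1 => // n /= Jn; rewrite /series/=.
rewrite (big_mkord xpredT) (bigD1 (Ordinal Jn))//= big1 ?addr0// => i iJ.
by apply: u0 => ij; move/eqP: iJ; apply; apply: val_inj.
Qed.

End GeometricSeries.

(** * The linear flow, its clock and the time-changed flow *)

Section Flow.
Context {R : realType}.
Notation K := (@solenoid R).
Implicit Types (s t r : R) (x y z : K) (i j J : nat).

Let exp2_gt0 i : 0 < 2 ^+ i :> R. Proof. by rewrite exprn_gt0. Qed.
Let exp4_gt0 i : 0 < 4 ^+ i :> R. Proof. by rewrite exprn_gt0. Qed.
Let exp4_neq0 i : 4 ^+ i != 0 :> R. Proof. by rewrite gt_eqF. Qed.
Let exp2_neq0 i : 2 ^+ i != 0 :> R. Proof. by rewrite gt_eqF. Qed.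
Let exp4E i : 4 ^+ i = 2 ^+ i * 2 ^+ i :> R.
Proof. by rewrite -exprMn; congr (_ ^+ _); ring. Qed.

(** The linear flow, which moves every point along its leaf. *)
Definition sh s x : K := mk (fun i => x i + s / 4 ^+ i).

Lemma shE s x i : sh s x i - (x i + s / 4 ^+ i) \is a Num.int.
Proof. by apply: (@mkE _ (fun i => x i + s / 4 ^+ i)); exact: compatD (coordP x) (compat_real s). Qed.

Lemma shD s t x : sh s (sh t x) = sh (t + s) x.
Proof.
apply: solenoidP => i.
rewrite (_ : _ - _ = (sh s (sh t x) i - (sh t x i + s / 4 ^+ i))
  + (sh t x i - (x i + t / 4 ^+ i))
  - (sh (t + s) x i - (x i + (t + s) / 4 ^+ i))); last by field.
by apply: rpredB; [apply: rpredD|]; exact: shE.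
Qed.

Lemma sh0 x : sh 0 x = x.
Proof.
by apply: solenoidP => i; have := shE 0 x i; rewrite mul0r addr0.
Qed.

Lemma tri_sh s x i c : tri (sh s x i + c) = tri (x i + s / 4 ^+ i + c).
Proof. by apply: tri_congr; rewrite opprD addrACA subrr addr0 shE. Qed.

Lemma sdist_sh s x y : mdist (sh s x) (sh s y) = mdist x y.
Proof.
suff le_sh r x' y' : mdist (sh r x') (sh r y') <= mdist x' y' :> R.
  apply/eqP; rewrite eq_le le_sh /=.
  by have := le_sh (- s) (sh s x) (sh s y); rewrite !shD subrr !sh0.
apply: sdist_le => i; rewrite (@tri_congr _ _ (x' i - y' i)); first exact: sdist_ge.
rewrite (_ : _ - _ = (sh r x' i - (x' i + r / 4 ^+ i))
  - (sh r y' i - (y' i + r / 4 ^+ i))); last by ring.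
by rewrite rpredB ?shE.
Qed.

Lemma sdist_shl s t x : mdist (sh s x) (sh t x) <= `|s - t|.
Proof.
apply: sdist_le => i; rewrite (@tri_congr _ _ ((s - t) / 4 ^+ i)); last first.
  rewrite (_ : _ - _ = (sh s x i - (x i + s / 4 ^+ i))
    - (sh t x i - (x i + t / 4 ^+ i))); last by field.
  by rewrite rpredB ?shE.
apply: le_trans (tri_le_norm _) _; rewrite normrM ler_wpM2l//.
rewrite ger0_norm ?invr_ge0 ?exprn_ge0// (@le_trans _ _ 1) ?exprn_ege1 ?ler1n//.
by rewrite invf_le1// exprn_ege1 ?ler1n.
Qed.

(** The i-th wave along the leaf of [x]: in [s] it has period 4^i and slope 2^-(i+2) up to sign. The
    heights need not be summable in [i]; their increments are. *)
Definition height x s i : R := 2 ^+ i / 4 * tri (x i + s / 4 ^+ i).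

Definition rise x s t i : R := height x t i - height x s i.

Lemma rise_geo x s t : geo (`|t - s| / 4) (rise x s t).
Proof.
move=> i; rewrite /rise /height -mulrBr normrM ger0_norm ?divr_ge0 ?exprn_ge0//.
apply: le_trans (ler_wpM2l _ (tri_lip_norm _ _)) _.
  by rewrite divr_ge0 ?exprn_ge0.
rewrite opprD addrACA subrr add0r -mulrBl normrM [`|_^-1|]ger0_norm; last first.
  by rewrite invr_ge0 exprn_ge0.
rewrite exp4E le_eqVlt; apply/orP; left; apply/eqP; field.
by rewrite exp2_neq0.
Qed.

(* [clock s x] is the time the flow [phi] below needs to move [x] to [sh s x]. *)
Definition clock s x : R := s + ssum (rise x 0 s).

Lemma clockB s t x : clock t x - clock s x = t - s + ssum (rise x s t).
Proof.
rewrite /clock opprD addrACA; congr (_ + _).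
rewrite -(ssumB (rise_geo x 0 t) (rise_geo x 0 s)); congr ssum.
by apply/funext => i; rewrite /rise /=; ring.
Qed.

(** The slopes 2^-(i+2) of the waves add up to 1/2, so a clock increases at a rate between 1/2 and
    3/2. *)
Lemma clock_lip s t x : `|clock t x - clock s x - (t - s)| <= `|t - s| / 2.
Proof.
rewrite clockB addrAC subrr add0r; apply: le_trans (ssum_le (rise_geo _ _ _)) _.
by lra.
Qed.

Lemma clock0 x : clock 0 x = 0.
Proof.
have := clock_lip 0 0 x; have := clockB 0 0 x; rewrite subrr => h _.
rewrite /clock add0r; move: h; rewrite subrr add0r => <- //.
Qed.

(** The cocycle identity, which makes [phi] a flow. *)
Lemma clockD s t x : clock (s + t) x = clock s x + clock t (sh s x).
Proof.
rewrite -(subrK (clock s x) (clock (s + t) x)) clockB [RHS]addrC; congr (_ + _).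
rewrite /clock (addrC s t) addrK; congr (_ + ssum _); apply/funext => i; rewrite /rise /height !tri_sh mul0r addr0.
by rewrite (addrC t s) mulrDl addrA.
Qed.

(** The stages up to [J] contribute equally to both clocks and cancel; the remaining slopes form a
    geometric tail. *)
Lemma clock_agree s x y J : x J - y J \is a Num.int ->
  `|clock s x - clock s y| <= `|s| / 2 ^+ J.
Proof.
move=> xyJ; rewrite /clock opprD addrACA subrr add0r.
rewrite -(ssumB (rise_geo x 0 s) (rise_geo y 0 s)).
apply: le_trans (ssum_tail (J := J) (geoB (rise_geo x 0 s) (rise_geo y 0 s)) _) _.
  move=> i /ltnW iJ; rewrite /rise /height /=.
  have xyi := compat_le (compatD (coordP x) (compatN (coordP y))) iJ xyJ.
  rewrite (@tri_congr _ (x i + s / _) (y i + s / 4 ^+ i)) ?subrr; last first.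
    by rewrite opprD addrACA subrr addr0.
  rewrite (@tri_congr _ (x i + 0 / _) (y i + 0 / 4 ^+ i)) ?subrr//.
  by rewrite opprD addrACA subrr addr0.
by rewrite subr0 ler_pM2r ?invr_gt0//; lra.
Qed.

(** At precision [J] every offset is a real number. The factor 8^J is 2^J from the weight in the
    metric times 4^J from the speed of the flow at stage [J]. *)
Lemma near_sh x y J : exists2 r, `|r| <= mdist x y * 8 ^+ J &
  y J - sh r x J \is a Num.int.
Proof.
have [k yxk _] := tri_int (y J - x J).
exists (4 ^+ J * (y J - x J - k%:~R)).
  rewrite normrM ger0_norm ?exprn_ge0// -yxk mulrC.
  rewrite (_ : 8 ^+ J = 2 ^+ J * 4 ^+ J); last by rewrite -exprMn; congr (_ ^+ _); ring.
  by rewrite mulrA ler_pM2r// triBC; exact: sdist_ge.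
set r := 4 ^+ J * _; rewrite (_ : _ - _ = k%:~R - (sh r x J - (x J + r / 4 ^+ J))).
  by rewrite rpredB ?intr_int ?shE.
by rewrite /r; field.
Qed.

Lemma clock_continuous s x e : 0 < e ->
  exists2 d : R, 0 < d & forall y, mdist x y < d -> `|clock s x - clock s y| < e.
Proof.
move=> e0; have [J /(_ _ (leqnn J)) hJ] := exp2_large (2 * `|s| / e).
have d0 : 0 < e / (6 * 8 ^+ J) by rewrite divr_gt0 ?mulr_gt0 ?exprn_gt0.
exists (e / (6 * 8 ^+ J)) => // y xy; have [r r_le /(clock_agree s)] := near_sh x y J.
(* The point [sh r x] agrees with [y] at stage [J], and the cocycle identity compares its clock with
   that of [x]. *)
have := clock_lip s (r + s) x; have := clock_lip 0 r x.
rewrite clock0 !subr0 addrK; have := clockD r s x.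
have {}r_le : `|r| < e / 6.
  apply: le_lt_trans r_le _.
  by rewrite -ltr_pdivlMr ?exprn_gt0// -mulrA -invfM.
have : `|s| / 2 ^+ J < e / 2.
  by move: hJ; rewrite ltr_pdivrMr// ltr_pdivrMr// => h; lra.
move: (`|s| / 2 ^+ J) => c c_lt ->; move: (clock r x) (clock s (sh r x)) => p q.
move: (clock s x) (clock s y) => a b; move: (`|r|) r_le => n n_lt.
rewrite ltr_norml !ler_norml => /andP[? ?] /andP[? ?] /andP[? ?].
by apply/andP; split; lra.
Qed.

Lemma clock_cont x : continuous (clock ^~ x).
Proof.
move=> s; apply/cvgrPdist_lt => e e0; near=> t.
have : `|s - t| < e / 2 by near: t; apply: cvgr_dist_lt => //; rewrite divr_gt0.
have := clock_lip t s x.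
have := ler_norm (s - t); have := ler_norm (- (s - t)); rewrite normrN.
move: (`|s - t|) => n ? ?; rewrite ler_norml => /andP[? ?] ?.
by rewrite ltr_norml; apply/andP; split; lra.
Unshelve. all: by end_near. Qed.

Lemma clock_surj t x : exists s, clock s x = t.
Proof.
have bnd := ler_norm t; have bnd' := ler_norm (- t); rewrite normrN in bnd'.
(* Since the clock has slope at least 1/2, a displacement of twice [t] in absolute value is enough
   for the intermediate value theorem. *)
have le : - (2 * `|t|) <= 2 * `|t| by have := normr_ge0 t; lra.
have h0 := clock_lip 0 (- (2 * `|t|)) x; have h1 := clock_lip 0 (2 * `|t|) x.
have n0 : `|2 * `|t| | = 2 * `|t| by rewrite ger0_norm ?mulr_ge0.
rewrite !clock0 !subr0 normrN n0 in h0.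
rewrite !clock0 !subr0 n0 in h1.
move: h0 h1; rewrite !ler_norml => /andP[h0 h0'] /andP[h1 h1'].
have [||s _ <-] := @IVT R (clock ^~ x) _ _ t le; last by exists s.
  by apply: continuous_subspaceT; exact: clock_cont.
by rewrite ge_min le_max; apply/andP; split; apply/orP; [left|right]; lra.
Qed.

(** The inverse of the clock: the displacement along the linear flow reached at time [t]. *)
Definition tau t x : R := projT1 (cid (clock_surj t x)).

Lemma clock_tau t x : clock (tau t x) x = t.
Proof. by rewrite /tau; case: cid. Qed.

Lemma clock_expand s t x : `|s - t| <= 2 * `|clock s x - clock t x|.
Proof.
set c := clock s x - clock t x; have := clock_lip t s x; rewrite -/c.
have := ler_normD c (- (c - (s - t))); rewrite normrN.
by rewrite (_ : c - (c - (s - t)) = s - t); [lra|ring].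
Qed.

Lemma clock_inj s t x : clock s x = clock t x -> s = t.
Proof.
move=> st; have := clock_expand s t x; rewrite st subrr normr0 mulr0 normr_le0.
by rewrite subr_eq0 => /eqP.
Qed.

Lemma tau_clock s x : tau (clock s x) x = s.
Proof. by apply: (@clock_inj _ _ x); rewrite clock_tau. Qed.

Definition phi t x : K := sh (tau t x) x.

Lemma phi_clock s x : phi (clock s x) x = sh s x.
Proof. by rewrite /phi tau_clock. Qed.

Lemma phi0 x : phi 0 x = x.
Proof. by rewrite -(clock0 x) phi_clock sh0. Qed.

Lemma phiD s t x : phi s (phi t x) = phi (t + s) x.
Proof.
rewrite {1 2}/phi shD /phi; congr sh; apply: (@clock_inj _ _ x).
by rewrite clockD !clock_tau.
Qed.

Lemma phi_lip s t x : mdist (phi s x) (phi t x) <= 2 * `|s - t|.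
Proof.
apply: le_trans (sdist_shl _ _ _) _; apply: le_trans (clock_expand _ _ x) _.
by rewrite !clock_tau.
Qed.

(** Moving both points by the same [tau t x] is an isometry; continuity of the clock makes [tau t x]
    and [tau t y] close. *)
Lemma phi_continuous t : continuous (phi t).
Proof.
move=> x A /nbhs_ballP [e /= e0 eA].
have [d d0 hd] := clock_continuous (tau t x) x (divr_gt0 e0 (ltr0Sn R 3)).
apply/nbhs_ballP; exists (Num.min d (e / 2)).
  by rewrite /= lt_min d0 divr_gt0.
move=> y; rewrite ballEmdist/= lt_min => /andP[xy xy'].
apply: eA; rewrite ballEmdist/=.
apply: le_lt_trans (metric_triangle _ (sh (tau t x) y) _) _; rewrite sdist_sh.
have h1 := sdist_shl (tau t x) (tau t y) y.
have h2 := clock_expand (tau t x) (tau t y) y; rewrite clock_tau in h2.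
have h3 := hd y xy; rewrite clock_tau distrC in h3.
apply: lt_le_trans (ltr_leD xy' (le_trans h1 h2)) _.
by move: h3; set c := `|_|; lra.
Qed.

End Flow.

(** * Leaves, unbounded drift between them, and density of half leaves *)

Section Leaves.
Context {R : realType}.
Notation K := (@solenoid R).
Implicit Types (s t r : R) (x y z : K) (i j J : nat).

Let exp2_gt0 i : 0 < 2 ^+ i :> R. Proof. by rewrite exprn_gt0. Qed.
Let exp4_gt0 i : 0 < 4 ^+ i :> R. Proof. by rewrite exprn_gt0. Qed.
Let exp4_neq0 i : 4 ^+ i != 0 :> R. Proof. by rewrite gt_eqF. Qed.

(** The coordinates of [sh s x] before reduction modulo 1, kept real so that they move continuously
    with [s]. *)
Definition phase x s i : R := x i + s / 4 ^+ i.

Lemma compat_phase x s : compat (phase x s).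
Proof. exact: compatD (coordP x) (compat_real s). Qed.

Lemma phase_add x s i j : phase x (s + 4 ^+ i) (i + j)%N = phase x s (i + j)%N + (4 ^+ j)^-1.
Proof. by rewrite /phase exprD; field; rewrite !exp4_neq0. Qed.

Definition same_cell (a b : R) := exists l, in_cell l a && in_cell l b.

(** Going up one stage divides a cell by four, after an integer translation; the result has length
    1/8 and endpoints in Z/8, so no half-integer is interior to it. *)
Lemma same_cell_quarter (a b a' b' : R) : same_cell a b ->
  4 * a' - a \is a Num.int -> b' = a' + (b - a) / 4 -> same_cell a' b'.
Proof.
move=> [l /andP[/andP[la al] /andP[lb bl]]] /intrP[m am] ->.
exists ((l + 2 * m) %/ 4)%Z; rewrite /in_cell.
set q := (_ %/ _)%Z.
have q0 : (q * 4)%:~R <= (l + 2 * m)%:~R :> R by rewrite ler_int /q; lia.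
have q1 : (l + 2 * m)%:~R <= (q * 4 + 3)%:~R :> R by rewrite ler_int /q; lia.
by rewrite !(intrD, intrM) in q0 q1; lra.
Qed.

Lemma same_cell_int (a : R) : 4 * a \is a Num.int -> same_cell a (a + 1 / 4).
Proof.
move=> /intrP[n an]; exists (n %/ 2)%Z; rewrite /in_cell.
set q := (_ %/ _)%Z.
have q0 : (q * 2)%:~R <= n%:~R :> R by rewrite ler_int /q; lia.
have q1 : n%:~R <= (q * 2 + 1)%:~R :> R by rewrite ler_int /q; lia.
by rewrite !(intrD, intrM) in q0 q1; lra.
Qed.

(** The two consecutive windows fill an interval of length 1/2, whose interior has at most one
    half-integer; one of the windows avoids it. *)
Lemma same_cell_or (a : R) :
  same_cell a (a + 1 / 4) \/ same_cell (a + 1 / 4) (a + 1 / 4 + 1 / 4).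
Proof.
have /andP[l0 l1] := floor_itv (2 * a); rewrite intrD in l1.
have [h|h] := leP (a + 1 / 4) (((Num.floor (2 * a))%:~R + 1) / 2); [left|right].
  by exists (Num.floor (2 * a)); rewrite /in_cell; lra.
by exists (Num.floor (2 * a) + 1); rewrite /in_cell intrD; lra.
Qed.

Lemma same_cell_phase x s i j :
  same_cell (phase x s i.+1) (phase x s i.+1 + 1 / 4) ->
  same_cell (phase x s (i + j.+1)%N) (phase x (s + 4 ^+ i) (i + j.+1)%N).
Proof.
move=> h; elim: j => [|j IH]; first by rewrite phase_add addn1 -div1r.
apply: same_cell_quarter IH _ _; first by rewrite addnS; exact: compat_phase.
rewrite !phase_add (exprS 4 j.+1); field.
by rewrite exp4_neq0.
Qed.

(* The stages below [i] are periodic, and those above [i] are affine on the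
window, so that the second difference only sees the stage [i]. *)
Lemma clock_second_difference x s i :
  same_cell (phase x s i.+1) (phase x s i.+1 + 1 / 4) ->
  clock (s + 4 ^+ i) x - 2 * clock (s + 4 ^+ i / 2) x + clock s x =
  2 ^+ i * tri (phase x s i) - 2 ^+ i / 4.
Proof.
move=> hs; have [s1 s1E] : exists s1, s1 = s + 4 ^+ i / 2 by eexists.
have [s2 s2E] : exists s2, s2 = s + 4 ^+ i by eexists.
have h1 : s1 - s = 4 ^+ i / 2 by rewrite s1E; ring.
have h2 : s2 - s1 = 4 ^+ i / 2 by rewrite s2E s1E; field.
rewrite -s1E -s2E; have := clockB s1 s2 x; have := clockB s s1 x; rewrite h1 h2.
move=> e1 e2; transitivity ((clock s2 x - clock s1 x) - (clock s1 x - clock s x)).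
  by ring.
rewrite e1 e2 opprD addrACA subrr add0r -(ssumB (rise_geo _ _ _) (rise_geo _ _ _)).
rewrite (@ssum_single _ _ i) => [|j ji].
  rewrite /= /rise /height -/(phase x s i) -/(phase x s1 i) -/(phase x s2 i).
  rewrite (_ : phase x s2 i = phase x s i + 1); last first.
    by have := phase_add x s i 0; rewrite -s2E addn0 expr0 invr1.
  rewrite (_ : phase x s1 i = phase x s i + 1 / 2); last first.
    by rewrite /phase s1E; field.
  rewrite tri_half (@tri_congr _ (_ + 1) (phase x s i)); last first.
    by rewrite addrAC subrr add0r rpred1.
  by field.
rewrite /= /rise /height -/(phase x s j) -/(phase x s1 j) -/(phase x s2 j).
have [ij|] := ltnP i j.
  have [k jE] : exists k, j = (i + k.+1)%N by exists (j - i).-1; lia.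
  have [l /andP[c0 c1]] := same_cell_phase k hs; rewrite -jE -s2E in c0 c1.
  have e0 : 0 <= (4 ^+ k.+1)^-1 / 2 :> R by rewrite divr_ge0 ?invr_ge0 ?exprn_ge0.
  have p2 : phase x s2 j = phase x s j + (4 ^+ k.+1)^-1 / 2 * 2.
    by rewrite jE s2E phase_add divfK.
  have p1 : phase x s1 j = phase x s j + (4 ^+ k.+1)^-1 / 2.
    by rewrite /phase s1E jE exprD; field; rewrite !exp4_neq0.
  rewrite p2 in c1; have := tri_midpoint c0 c1 e0; rewrite -p2 -p1 => h.
  by rewrite -!mulrBr (_ : _ - _ = 0) ?mulr0// -h; ring.
rewrite leq_eqVlt => /orP[/eqP //|ij].
have [k iE] : exists k, i = (j + k.+1)%N by exists (i - j).-1; lia.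
rewrite (@tri_congr _ (phase x s1 j) (phase x s j)); last first.
  rewrite /phase s1E iE (_ : _ - _ = 2 * 4 ^+ k).
    by rewrite rpredM ?rpredX// natr_int.
  by rewrite exprD exprS; field.
rewrite (@tri_congr _ (phase x s2 j) (phase x s j)) ?subrr//.
rewrite /phase s2E iE (_ : _ - _ = 4 * 4 ^+ k).
  by rewrite rpredM ?rpredX// natr_int.
by rewrite exprD exprS; field.
Qed.

(** Start a second difference when the i-th wave of [x] vanishes: the values for [x] and [y] then
    differ by exactly the left-hand side, and the coefficients 1, 2, 1 give 4 B. *)
Lemma clock_bounded_coord x y (B : R) :
  (forall s, 0 <= s -> `|clock s x - clock s y| <= B) ->
  forall i, 2 ^+ i * tri (y i - x i) <= 4 * B.
Proof.
move=> hB i; pose s0 := 4 ^+ i * (1 - x i).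
have s00 : 0 <= s0.
  by have /andP[_ /ltW x1] := coord_itv x i; rewrite mulr_ge0 ?exprn_ge0// subr_ge0.
have ph0 : phase x s0 i = 1 by rewrite /phase /s0; field.
have step z s : phase z (s + 4 ^+ i) i.+1 = phase z s i.+1 + 1 / 4.
  by have := phase_add z s i 1; rewrite addn1 expr1 div1r.
have int0 : 4 * phase x s0 i.+1 \is a Num.int.
  by rewrite -(subrK (phase x s0 i) (4 * _)) rpredD ?compat_phase// ph0 rpred1.
(* For [x] both windows starting at [s0] and at [s0 + 4 ^+ i] lie in a cell, their endpoints at
   stage i+1 being quarter-integers; for [y] at least one of them does. *)
have [s [s_ge0 phs cx cy]] : exists s, [/\ 0 <= s, phase x s i \is a Num.int,
    same_cell (phase x s i.+1) (phase x s i.+1 + 1 / 4) &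
    same_cell (phase y s i.+1) (phase y s i.+1 + 1 / 4)].
  have [h|h] := same_cell_or (phase y s0 i.+1).
    by exists s0; split=> //; [rewrite ph0 rpred1|exact: same_cell_int].
  exists (s0 + 4 ^+ i); rewrite !step; split=> //.
  - by rewrite addr_ge0 ?exprn_ge0.
  - have := phase_add x s0 i 0; rewrite addn0 expr0 invr1 => ->.
    by rewrite ph0 rpredD ?rpred1.
  - apply: same_cell_int; rewrite mulrDr rpredD//.
    by rewrite div1r mulfV ?rpred1.
have e1 := clock_second_difference cx; have e2 := clock_second_difference cy.
have triy : tri (phase y s i) = tri (y i - x i).
  by apply: tri_congr; rewrite /phase opprB addrCA addrAC subrr add0r -/(phase x s i).
have trix : tri (phase x s i) = 0 by apply/eqP; rewrite tri_eq0.
rewrite triy in e2; rewrite trix mulr0 in e1.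
have p4 := exprn_ge0 i (ler0n R 4).
have := hB s s_ge0; have := hB (s + 4 ^+ i / 2) (addr_ge0 s_ge0 (divr_ge0 p4 (ler0n R 2))).
have := hB (s + 4 ^+ i) (addr_ge0 s_ge0 p4).
by rewrite !ler_norml => /andP[? ?] /andP[? ?] /andP[? ?]; lra.
Qed.

Definition leaf x y := exists r, y = sh r x.

(** Late offsets have small representatives [b i]. Then 4 b_{i+1} - b_i is an integer of absolute
    value below 1, hence 0, and the offset is that of the real number 4^J b_J. *)
Lemma coord_bounded_leaf x y (C : R) :
  (forall i, 2 ^+ i * tri (y i - x i) <= C) -> leaf x y.
Proof.
move=> hC; have [J hJ] := exp2_large (8 * C).
have small i : (J <= i)%N -> tri (y i - x i) < 1 / 8.
  move=> /hJ; have := hC i; have := exp2_gt0 i; move: (2 ^+ i) (tri _) => p q *.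
  by nra.
have /choice[k hk] i : exists k : int, tri (y i - x i) = `|y i - x i - k%:~R|.
  by have [k] := tri_int (y i - x i); exists k.
pose b i := y i - x i - (k i)%:~R.
have bS i : (J <= i)%N -> 4 * b i.+1 = b i.
  move=> Ji; apply/eqP; rewrite -subr_eq0; apply/eqP/int_small.
    rewrite (_ : _ - _ = (4 * y i.+1 - y i) - (4 * x i.+1 - x i)
      - (4 * (k i.+1)%:~R - (k i)%:~R)); last by rewrite /b; ring.
    apply: rpredB; first by apply: rpredB; exact: coordP.
    by apply: rpredB; rewrite ?intr_int// rpredM ?intr_int// natr_int.
  have := small i Ji; have := small i.+1 (leqW Ji); rewrite !hk -/(b i) -/(b i.+1).
  by rewrite !ltr_norml => /andP[? ?] /andP[? ?]; apply/andP; split; lra.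
have bJ n : b (J + n)%N = b J / 4 ^+ n.
  elim: n => [|n IH]; first by rewrite addn0 expr0 divr1.
  apply: (@mulfI _ 4) => //; rewrite addnS bS ?leq_addr// IH exprS; field.
  by rewrite exp4_neq0.
exists (4 ^+ J * b J); apply: solenoidP.
set r := 4 ^+ J * b J; have hJn n : y (J + n)%N - sh r x (J + n)%N \is a Num.int.
  rewrite (_ : _ - _ = (k (J + n)%N)%:~R + (b (J + n)%N - b J / 4 ^+ n)
    - (sh r x (J + n)%N - (x (J + n)%N + r / 4 ^+ (J + n)))).
    by rewrite bJ subrr addr0; apply: rpredB; [exact: intr_int|exact: shE].
  by rewrite /r /b exprD; field; rewrite !exp4_neq0.
move=> i; apply: (compat_le (compatD (coordP y) (compatN (coordP _)))); last exact: hJn.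
exact: leq_addl.
Qed.

Lemma leaf_refl x : leaf x x.
Proof. by exists 0; rewrite sh0. Qed.

Lemma leaf_sym x y : leaf x y -> leaf y x.
Proof. by move=> [r ->]; exists (- r); rewrite shD subrr sh0. Qed.

Lemma leaf_trans x y z : leaf x y -> leaf y z -> leaf x z.
Proof. by move=> [r ->] [t ->]; exists (r + t); rewrite shD. Qed.

Lemma leaf_phi t x : leaf x (phi t x).
Proof. by exists (tau t x). Qed.

Lemma leafE x y : leaf x y -> exists t, y = phi t x.
Proof. by move=> [r ->]; exists (clock r x); rewrite phi_clock. Qed.

Lemma leaf_phi2 s t x y : leaf (phi s x) (phi t y) -> leaf x y.
Proof.
move=> h; apply: leaf_trans (leaf_phi s x) _; apply: leaf_trans h _.
by apply: leaf_sym; exact: leaf_phi.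
Qed.

(** The constant offset 1/3 is compatible since 4/3 - 1/3 is an integer, while the offset r / 4^i of
    a point on the leaf tends to 0. *)
Lemma exists_off_leaf x : exists y, ~ leaf x y.
Proof.
have c3 : compat (fun i => x i + 1 / 3).
  apply: (compatD (coordP x)) => i; rewrite (_ : _ - _ = 1) ?rpred1//.
  by field.
exists (mk (fun i => x i + 1 / 3)) => -[r mkr].
have [J /(_ _ (leqnn J)) hJ] := exp2_large (4 * `|r|).
have : tri (1 / 3) = tri (r / 4 ^+ J).
  apply: tri_congr; rewrite (_ : _ - _ = (sh r x J - (x J + r / 4 ^+ J))
    - (mk (fun i => x i + 1 / 3) J - (x J + 1 / 3))); last by rewrite -mkr; ring.
  by apply: rpredB; [exact: shE|exact: (mkE J c3)].
rewrite tri_small ger0_norm//; try lra.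
have := tri_le_norm (r / 4 ^+ J); rewrite normrM [`|_^-1|]ger0_norm ?invr_ge0 ?exprn_ge0//.
have : `|r| / 4 ^+ J < 1 / 4; last lra.
rewrite ltr_pdivrMr//; have : 2 ^+ J <= 4 ^+ J :> R by rewrite lerXn2r ?nnegrE ?ler_nat.
by lra.
Qed.

Lemma off_leaf_drift x y : ~ leaf x y ->
  forall B : R, exists n : nat, B < `|tau n%:R y - tau n%:R x|.
Proof.
move=> nl B; apply: contrapT => nB; apply: nl.
have {}nB n : `|tau n%:R y - tau n%:R x| <= B.
  by rewrite leNgt; apply/negP => h; apply: nB; exists n.
(* Passing from integer times to all [s]: [clock s x] is within 1 of some [n], so [s] is within 2 +
   B of [tau n%:R y], and the clock of [y] has slope at most 3/2. *)
apply: (@coord_bounded_leaf _ _ (4 * (1 + 3 / 2 * (2 + B)))).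
apply: clock_bounded_coord => s s0.
have t0 : 0 <= clock s x.
  have := clock_lip 0 s x; rewrite clock0 !subr0 (ger0_norm s0) ler_norml => /andP[? ?].
  by lra.
have /andP[n0 n1] := truncn_itv t0; set n := Num.truncn _ in n0 n1.
rewrite -natr1 in n1.
have n2 : `|clock s x - n%:R| <= 1 by rewrite ler_norml; apply/andP; split; lra.
have h1 := nB n; have h2 := clock_expand s (tau n%:R x) x.
have h3 := clock_lip (tau n%:R y) s y; rewrite !clock_tau in h2 h3.
have h4 : `|s - tau n%:R y| <= 2 + B.
  rewrite (_ : s - _ = (s - tau n%:R x) - (tau n%:R y - tau n%:R x)); last by ring.
  by apply: le_trans (ler_normB _ _) _; lra.
rewrite (_ : clock s x - clock s y = (clock s x - n%:R)
  - ((clock s y - n%:R - (s - tau n%:R y)) + (s - tau n%:R y))); last by ring.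
apply: le_trans (ler_normB _ _) _.
have h6 := ler_normD (clock s y - n%:R - (s - tau n%:R y)) (s - tau n%:R y).
by lra.
Qed.

Lemma discrete_ivt (u : nat -> R) s v : u 0%N <= s ->
  (forall n, `|u n.+1 - u n| <= v) -> (exists n, s <= u n) -> exists n, `|u n - s| <= v.
Proof.
move=> u0 hu ex; have := ex_minnP ex; case: ex_minnP => n sn nmin _.
have v0 : 0 <= v by apply: le_trans (hu 0%N); exact: normr_ge0.
exists n; case: n => [|n] in sn nmin *.
  by rewrite (_ : u 0%N - s = 0) ?normr0//; lra.
have un : u n < s by rewrite ltNge; apply/negP => /nmin; rewrite ltnn.
have := hu n; rewrite !ler_norml => /andP[? ?].
by apply/andP; split; lra.
Qed.

(** At precision [J], the point [y] is [sh d0 x], so its orbit at time [n] looks like the orbit of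
    [x] at time [clock (d0 + tau n%:R y) x]. The excess of this time over [n] is the relative time
    shift. *)
Lemma off_leaf_approach_aux x y (d0 s : R) J (n : nat) :
  y J - (x J + d0 / 4 ^+ J) \is a Num.int ->
  `|clock (d0 + tau n%:R y) x - n%:R - s| <= 2 / 2 ^+ J ->
  mdist (phi n%:R y) (phi s (phi n%:R x)) <= 5 / 2 ^+ J.
Proof.
move=> yx hs; set s' := clock _ _ - n%:R in hs.
apply: le_trans (metric_triangle _ (phi s' (phi n%:R x)) _) _.
(* One unit comes from agreement at stage [J], and four from the error in the shift, doubled by
   [phi_lip]. *)
have -> : 5 / 2 ^+ J = (2 ^+ J)^-1 + 2 * (2 / 2 ^+ J) :> R.
  by field; rewrite gt_eqF.
apply: lerD; last by apply: le_trans (phi_lip _ _ _) _; rewrite ler_pM2l.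
apply: sdist_agree; rewrite phiD (addrC n%:R) /s' subrK phi_clock /phi.
set t := tau _ y; rewrite (_ : _ - _ = (y J - (x J + d0 / 4 ^+ J))
  + (sh t y J - (y J + t / 4 ^+ J)) - (sh (d0 + t) x J - (x J + (d0 + t) / 4 ^+ J))).
  by apply: rpredB; [apply: rpredD yx _|]; exact: shE.
by field.
Qed.

(** In one unit of time [y] moves by some [d] of size at most 2; the same displacement is timed by
    the clocks of two points that agree at stage [J]. *)
Lemma off_leaf_step x y (d0 : R) J (n : nat) :
  y J - (x J + d0 / 4 ^+ J) \is a Num.int ->
  `|clock (d0 + tau n.+1%:R y) x - n.+1%:R - (clock (d0 + tau n%:R y) x - n%:R)|
    <= 2 / 2 ^+ J.
Proof.
move=> yx; set t := tau n%:R y; set t' := tau n.+1%:R y; pose d := t' - t.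
have e1 : clock (d0 + t') x = clock (d0 + t) x + clock d (sh (d0 + t) x).
  by rewrite -clockD; congr clock; rewrite /d; ring.
have e2 : n.+1%:R = n%:R + clock d (sh t y).
  rewrite -[LHS](clock_tau _ y) -[in RHS](clock_tau n%:R y) -/t -/t' -clockD.
  by congr clock; rewrite /d; ring.
have hd : `|d| <= 2.
  have := clock_expand t' t y; rewrite (_ : clock t' y - clock t y = 1).
    by rewrite normr1 mulr1.
  by rewrite !clock_tau -natr1; ring.
rewrite e1 {1}e2 (_ : _ - _ = clock d (sh (d0 + t) x) - clock d (sh t y)); last by ring.
apply: le_trans (clock_agree (J := J) _ _) _; last by rewrite ler_pM2r ?invr_gt0.
rewrite (_ : _ - _ = (sh (d0 + t) x J - (x J + (d0 + t) / 4 ^+ J))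
  - (sh t y J - (y J + t / 4 ^+ J)) - (y J - (x J + d0 / 4 ^+ J))).
  by apply: rpredB => //; apply: rpredB; exact: shE.
by field.
Qed.

Lemma tau0 x : tau 0 x = 0.
Proof. by have := tau_clock 0 x; rewrite clock0. Qed.

(** Time 0 is allowed; where a positive time is needed, this is applied to the images of the points
    under [phi 1]. *)
Definition approaches x y s :=
  forall e, 0 < e -> exists n : nat, mdist (phi n%:R y) (phi s (phi n%:R x)) < e.

Lemma off_leaf_approach x y : ~ leaf x y ->
  (forall s, 0 <= s -> approaches x y s) \/ (forall s, s <= 0 -> approaches x y s).
Proof.
move=> nl; have drift := off_leaf_drift nl.
have small (e : R) : 0 < e -> exists J, 5 / 2 ^+ J < e.
  move=> e0; have [J /(_ _ (leqnn J)) hJ] := exp2_large (5 / e).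
  by exists J; move: hJ; rewrite ltr_pdivrMr// ltr_pdivrMr// mulrC.
have [up|nup] := pselect (forall B : R, exists n : nat, B < tau n%:R y - tau n%:R x).
- left=> s s0 e e0; have [J hJ] := small e e0.
  (* The offset is free up to an integer; subtracting 1 makes [d0] nonpositive, so that the time
     shift starts below [s]. *)
  pose d0 : R := 4 ^+ J * (y J - x J - 1).
  have yx : y J - (x J + d0 / 4 ^+ J) \is a Num.int.
    by rewrite (_ : _ - _ = 1) ?rpred1// /d0; field.
  have d00 : d0 <= 0.
    rewrite pmulr_rle0//.
    by have /andP[? ?] := coord_itv x J; have /andP[? ?] := coord_itv y J; lra.
  have [n hn] : exists n, `|clock (d0 + tau n%:R y) x - n%:R - s| <= 2 / 2 ^+ J.
    apply: (@discrete_ivt (fun n => clock (d0 + tau n%:R y) x - n%:R)).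
    + rewrite (tau0 y) addr0 subr0.
      have := clock_lip 0 d0 x; rewrite clock0 !subr0 (ler0_norm d00).
      by rewrite ler_norml => /andP[? ?]; lra.
    + by move=> n; exact: off_leaf_step.
    (* The displacement then exceeds 2 s, and slope at least 1/2 brings the shift above [s]. *)
    + have [n hn] := up (2 * s - d0); exists n.
      have := clock_lip (tau n%:R x) (d0 + tau n%:R y) x; rewrite clock_tau.
      rewrite (_ : `|d0 + _ - _| = d0 + tau n%:R y - tau n%:R x); last first.
        by rewrite ger0_norm//; lra.
      by rewrite ler_norml => /andP[? ?]; lra.
  by exists n; apply: le_lt_trans hJ; exact: off_leaf_approach_aux hn.
right=> s s0 e e0; have [J hJ] := small e e0.
have [B hB] : exists B, forall n : nat, tau n%:R y - tau n%:R x <= B.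
  apply: contrapT => nB; apply: nup => B; apply: contrapT => nn; apply: nB; exists B.
  by move=> n; rewrite leNgt; apply/negP => h; apply: nn; exists n.
pose d0 : R := 4 ^+ J * (y J - x J + 1).
have yx : y J - (x J + d0 / 4 ^+ J) \is a Num.int.
  by rewrite (_ : _ - _ = -1) ?rpredN ?rpred1// /d0; field.
have d00 : 0 <= d0.
  rewrite pmulr_rge0//.
  by have /andP[? ?] := coord_itv x J; have /andP[? ?] := coord_itv y J; lra.
have [n hn] : exists n, `|- (clock (d0 + tau n%:R y) x - n%:R) - - s| <= 2 / 2 ^+ J.
  apply: (@discrete_ivt (fun n => - (clock (d0 + tau n%:R y) x - n%:R))).
  + rewrite (tau0 y) addr0 subr0.
    have := clock_lip 0 d0 x; rewrite clock0 !subr0 (ger0_norm d00).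
    by rewrite ler_norml => /andP[? ?]; lra.
  + by move=> n; rewrite opprK addrC distrC -opprB normrN distrC; exact: off_leaf_step.
  (* The term [Num.max B 0] excludes a nonnegative drift, which would be at most [B]; the drift is
     therefore below 2 s - d0. *)
  + have [n hn] := drift (Num.max B 0 + d0 - 2 * s); exists n.
    have := hB n; have Bm : B <= Num.max B 0 by rewrite le_max lexx.
    have m0 : 0 <= Num.max B 0 by rewrite le_max lexx orbT.
    move: (Num.max B 0) hn Bm m0 => M hn BM m0 nB.
    have neg : tau n%:R y - tau n%:R x < 0.
      by rewrite ltNge; apply/negP => h; rewrite ger0_norm in hn => //; lra.
    rewrite ltr0_norm// in hn.
    have := clock_lip (tau n%:R x) (d0 + tau n%:R y) x; rewrite clock_tau.
    rewrite (_ : `|d0 + _ - _| = - (d0 + tau n%:R y - tau n%:R x)); last first.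
      by rewrite ler0_norm//; lra.
    by rewrite ler_norml => /andP[? ?]; lra.
exists n; apply: le_lt_trans hJ; apply: off_leaf_approach_aux yx _.
by rewrite -normrN opprB addrC; move: hn; rewrite opprK.
Qed.

Lemma half_leaf_dense x y (c e : R) : c = 1 \/ c = - 1 -> 0 < e ->
  exists2 s, 0 <= c * s & mdist (phi s x) y < e.
Proof.
move=> hc e0; have [J /(_ _ (leqnn J)) hJ] := exp2_large (1 / e).
have c_int : c \is a Num.int by case: hc => ->; rewrite ?rpredN rpred1.
(* Adding the integer [c] gives [r] the sign of [c] and does not affect agreement at stage [J]. *)
pose r : R := 4 ^+ J * (y J - x J + c); exists (clock r x).
  have /andP[? ?] := coord_itv x J; have /andP[? ?] := coord_itv y J.
  have := clock_lip 0 r x; rewrite clock0 !subr0.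
  case: hc => cE; rewrite cE ?mul1r ?mulN1r.
    have r0 : 0 <= r by rewrite /r cE mulr_ge0 ?exprn_ge0//; lra.
    by rewrite (ger0_norm r0) ler_norml => /andP[? ?]; lra.
  have r0 : r <= 0 by rewrite /r cE pmulr_rle0//; lra.
  by rewrite (ler0_norm r0) ler_norml => /andP[? ?]; lra.
rewrite phi_clock; apply: le_lt_trans (_ : (2 ^+ J)^-1 < e); last first.
  by rewrite -div1r ltr_pdivrMr// mulrC -ltr_pdivrMr.
apply: sdist_agree; rewrite (_ : _ - _ = (sh r x J - (x J + r / 4 ^+ J)) + c).
  by apply: rpredD => //; exact: shE.
by rewrite /r; field.
Qed.

End Leaves.

(** * Minimal sets of continuous maps and forward orbit closures *)

Section MinimalSets.
Context {T : topologicalType}.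
Implicit Types (f : T -> T) (W M N : set T).

Definition invclosed f W := [/\ closed W, W !=set0 & forall z, W z -> W (f z)].

Definition minimal_set f M :=
  invclosed f M /\ forall N, invclosed f N -> N `<=` M -> M `<=` N.

Lemma minimal_set_exists f W : compact [set: T] -> invclosed f W ->
  exists2 M, minimal_set f M & M `<=` W.
Proof.
move=> cT iW; pose S := {N : set T | invclosed f N /\ N `<=` W}.
pose W0 : S := exist _ W (conj iW (@subset_refl _ W)).
pose r (s t : S) := `[< sval t `<=` sval s >].
have [||A totA|[M [iM MW]] maxM] := @ZL_preorder S W0 r.
- by move=> t; apply/asboolP.
- by move=> a b c /asboolP ab /asboolP bc; apply/asboolP; exact: subset_trans bc ab.
- have [[s0 As0]|A0] := pselect (exists s, A s); last first.
    by exists W0 => s As; case: A0; exists s.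
  (* A chain generates a proper filter; a cluster point of it lies in every member, so the
     intersection is a lower bound for Zorn's lemma. *)
  pose F := filter_from A (fun s => sval s).
  have FF : ProperFilter F.
    apply: filter_from_proper; last by move=> s _; have [[]] := svalP s.
    apply: filter_from_filter; first by exists s0.
    move=> s t As At; have [/asboolP st|/asboolP ts] := totA s t As At.
      by exists t => // z tz; split=> //; exact: st.
    by exists s => // z sz; split=> //; exact: ts.
  have [z [_ Fz]] := cT F FF filterT.
  have Az s : A s -> sval s z.
    move=> As; have [[cs _ _] _] := svalP s; apply: cs => V Vz.
    by apply: Fz => //; exists s.
  have iI : invclosed f (\bigcap_(s in A) sval s).
    split; last 1 first.
    + by move=> w Iw s As; have [[_ _ fs] _] := svalP s; apply: fs; exact: Iw.
    + by apply: closed_bigI => s _; have [[]] := svalP s.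
    + by exists z.
  have IW : \bigcap_(s in A) sval s `<=` W.
    by move=> w /(_ s0 As0); have [_] := svalP s0; apply.
  exists (exist (fun N => invclosed f N /\ N `<=` W) _ (conj iI IW)) => s As; apply/asboolP => w /=.
  by move=> /(_ s As).
- exists M => //; split=> // N iN NM.
  have NW := subset_trans NM MW.
  by have /asboolP := maxM (exist (fun N => invclosed f N /\ N `<=` W) N (conj iN NW)) (asboolT NM).
Qed.

(** The points of [M] that [g] sends into [W] form a nonempty closed invariant subset, hence all of
    [M]. *)
Lemma minimal_set_semiconj (T' : topologicalType) f (f' : T' -> T') (g : T -> T')
    M (W : set T') :
  continuous g -> (forall z, g (f z) = f' (g z)) -> minimal_set f M ->
  closed W -> (forall z, W z -> W (f' z)) ->
  forall m, M m -> W (g m) -> forall z, M z -> W (g z).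
Proof.
move=> cg gf [[cM M0 fM] minM] cW fW m Mm Wm.
have sub : M `<=` M `&` (g @^-1` W).
  apply: minM => [|z []//]; split; last 1 first.
  - by move=> z [Mz Wz]; split; [exact: fM|rewrite /= gf; exact: fW].
  - by apply: closedI => //; apply: closed_comp => // ? _; exact: cg.
  - by exists m.
by move=> z /sub[].
Qed.

Lemma minimal_set_preimage f finv M : cancel f finv -> cancel finv f -> continuous finv ->
  minimal_set f M -> forall z, M z -> M (finv z).
Proof.
move=> fK finvK cf [[cM [m Mm] fM] minM].
have sub : M `<=` finv @^-1` M.
  apply: minM => [|z Mz]; last by rewrite -(finvK z); exact: fM.
  split; last 1 first.
  - by move=> z Mz; rewrite /= fK -(finvK z); exact: fM.
  - by apply: closed_comp => // ? _; exact: cf.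
  - by exists (f m); rewrite /= fK.
by move=> z /sub.
Qed.

(** It begins at the first iterate, so that [z] is recurrent when it lies in the closure. *)
Definition forward_orbit f z := range (fun n => iter n.+1 f z).

Lemma closure_orbit_invclosed f z : continuous f ->
  invclosed f (closure (forward_orbit f z)).
Proof.
move=> cf; split; first exact: closed_closure.
  by exists (f z); apply: subset_closure; exists 0%N.
move=> w cw V Vw; have [_ [[n _ <-] Vn]] := cw _ (cf w V Vw).
by exists (iter n.+2 f z); split=> //; exists n.+1.
Qed.

Lemma closure_orbit_min f z N : closed N -> (forall w, N w -> N (f w)) -> N z ->
  closure (forward_orbit f z) `<=` N.
Proof.
move=> cN fN Nz w cw; apply: cN => V Vw.
have [_ [[n _ <-] Vn]] := cw V Vw; exists (iter n.+1 f z); split=> //.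
by elim: n.+1 => [//|k IH] /=; exact: fN.
Qed.

End MinimalSets.

(** * The time-one map and limits of approaching pairs *)

Section SolenoidFlow.
Context {R : realType}.
Notation K := (@solenoid R).
Implicit Types (s t r : R) (x y z : K).

Lemma iter_phi n y : iter n (phi 1) y = phi n%:R y.
Proof.
by elim: n => [|n IH] /=; rewrite ?phi0// IH phiD natr1.
Qed.

Lemma phiK t : cancel (phi t) (phi (- t) : K -> K).
Proof. by move=> x; rewrite phiD subrr phi0. Qed.

Lemma phiNK t : cancel (phi (- t)) (phi t : K -> K).
Proof. by move=> x; rewrite phiD addNr phi0. Qed.

Lemma phi_comm s t x : phi s (phi t x) = phi t (phi s x).
Proof. by rewrite !phiD addrC. Qed.

Definition phi_homeo : homeo K :=
  Homeo (phiK 1) (phiNK 1) (@phi_continuous R 1) (@phi_continuous R (- 1)).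

Lemma phi_continuous2 : continuous (fun p : R * K => phi p.1 p.2).
Proof.
move=> [t x] A /nbhs_ballP[e /= e0 eA].
have /nbhs_ballP[d /= d0 hd] : nbhs x (phi t @^-1` ball (phi t x) (e / 2)).
  by apply: phi_continuous; apply: nbhsx_ballx; rewrite divr_gt0.
apply/nbhs_ballP; exists (Num.min d (e / 4)); first by rewrite /= lt_min d0 divr_gt0.
move=> [t' x'] [/= tt' xx']; apply: eA.
have {}hd : ball (phi t x) (e / 2) (phi t x').
  by apply: hd; apply: le_ball xx'; rewrite ge_min lexx.
rewrite (splitr e); apply: ball_triangle hd _; rewrite ballEmdist/=.
apply: le_lt_trans (phi_lip _ _ _) _.
have : `|t - t'| < e / 4 by apply: lt_le_trans tt' _; rewrite ge_min lexx orbT.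
by lra.
Qed.

(** A cluster point of the orbit of [(y, x)], along times when the two solenoid points nearly differ
    by [phi s], supplies [z] and [x1]. The factor [X] carries the companion system along. *)
Lemma approaches_limit (X : topologicalType) (T : X -> X) (x : X) y y' s
    (W : set ((K * K) * X)) :
  compact [set: X] -> approaches y y' s -> closed W ->
  (forall n : nat, W ((phi n%:R y, phi n%:R y'), iter n T x)) ->
  exists z (x1 : X), W ((z, phi s z), x1).
Proof.
move=> cX hs cW hW.
have /choice[n_ hn] (J : nat) : exists n : nat,
    mdist (phi n%:R y') (phi s (phi n%:R y)) < (2 ^+ J)^-1.
  by apply: hs; rewrite invr_gt0 exprn_gt0.
pose w J : K * X := (phi (n_ J)%:R y, iter (n_ J) T x).
have cKX : compact [set: K * X].
  by rewrite -setXTT; apply: compact_setX => //; exact: solenoid_compact.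
have [[z x1] [_ clz]] := cKX (w @ \oo) _ filterT.
exists z, x1; apply: cW => V [[P V2] /= [[[A B] /= [Az Bz] sP] V2x] sV].
have /nbhs_ballP[e /= e0 eB] := Bz.
have [J0 hJ0] := exp2_large (2 / e).
pose E := [set p | exists2 J, (J0 <= J)%N & p = w J].
have FE : (w @ \oo) E by exists J0 => // J J0J; exists J.
have e20 : 0 < e / 2 by rewrite divr_gt0.
have Uz : nbhs (z, x1) ((A `&` phi s @^-1` ball (phi s z) (e / 2)) `*` V2).
  exists (A `&` phi s @^-1` ball (phi s z) (e / 2), V2) => //=; split=> //.
  by apply: filterI => //; apply: phi_continuous; exact: nbhsx_ballx.
have [_ [[J J0J ->] [[/= Aw Bw] V2w]]] := clz _ _ FE Uz.
exists ((phi (n_ J)%:R y, phi (n_ J)%:R y'), iter (n_ J) T x); split=> //.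
apply: sV; split=> //=; apply: sP; split=> //=; apply: eB.
rewrite (splitr e); apply: ball_triangle Bw _; rewrite ballEmdist/= metric_sym.
apply: lt_trans (hn J) _; have := hJ0 J J0J.
by rewrite -[e / 2]invrK ltf_pV2 ?posrE ?invr_gt0 ?exprn_gt0// invf_div.
Qed.

End SolenoidFlow.

Lemma continuous_pair (A B C : topologicalType) (f : A -> B) (g : A -> C) :
  continuous f -> continuous g -> continuous (fun a => (f a, g a)).
Proof.
move=> cf cg a.
exact: (@cvg_pair A B C (nbhs a) (nbhs (f a)) (nbhs (g a)) _ _ _ f g (cf a) (cg a)).
Qed.

(** * Orbit closures in the solenoid, in its square, and in products with minimal systems *)

Section SolenoidDynamics.
Context {R : realType}.
Notation K := (@solenoid R).
Notation S := (phi 1 : K -> K).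
Implicit Types (s t r : R) (x y z : K).

Lemma off_leaf_direction x y : ~ leaf x y ->
  exists2 c : R, c = 1 \/ c = - 1 & forall s, 0 <= c * s -> approaches x y s.
Proof.
move=> /off_leaf_approach[h|h]; [exists 1|exists (- 1)]; rewrite ?mulN1r; auto.
- by move=> s; rewrite mul1r; exact: h.
- by move=> s; rewrite mulN1r oppr_ge0; exact: h.
Qed.

Lemma half_leaf_closed (N : set K) x (c : R) : c = 1 \/ c = - 1 -> closed N ->
  (forall s, 0 <= c * s -> N (phi s x)) -> forall y, N y.
Proof.
move=> hc cN hN y; apply: cN => V /nbhs_ballP[e /= e0 eV].
have [s cs sy] := half_leaf_dense x y hc e0.
exists (phi s x); split; first exact: hN.
by apply: eV; rewrite ballEmdist/= metric_sym.
Qed.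

Lemma iter_prod_map (A B : Type) (f : A -> A) (g : B -> B) n (p : A * B) :
  iter n (prod_map f g) p = (iter n f p.1, iter n g p.2).
Proof. by elim: n => [|n IH]; [case: p|rewrite /= IH]. Qed.

Lemma minimal_set_full (N : set K) : minimal_set S N -> N = [set: K].
Proof.
move=> minN; have [[cN [y Ny] SN] _] := minN.
have iterN n z : N z -> N (phi n%:R z).
  by rewrite -iter_phi => Nz; elim: n => [//|n IH]; exact: SN.
have hK : hausdorff_space K := @metric_hausdorff R K.
(* Flowing [N] for times in [0, 1] gives a compact set containing a half leaf, hence everything. *)
have full z : exists r n, N n /\ z = phi r n.
  pose g (p : R * K) := phi p.1 p.2.
  have cI : compact (g @` (`[0, 1] `*` N)).
    apply: continuous_compact; first by apply: continuous_subspaceT; exact: phi_continuous2.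
    apply: compact_setX; first exact: segment_compact.
    by apply: subclosed_compact cN (@solenoid_compact R) _.
  have := half_leaf_closed (or_introl erefl) (compact_closed hK cI) _ z.
  move=> /(_ y)[].
    move=> s; rewrite mul1r => s0; have /andP[n0 n1] := truncn_itv s0.
    exists (s - (Num.truncn s)%:R, phi (Num.truncn s)%:R y).
      split=> /=; last exact: iterN.
      by rewrite in_itv/=; rewrite -natr1 in n1; apply/andP; split; lra.
    by rewrite /g/= phiD addrC subrK.
  by move=> [r n] [_ /= Nn] <-; exists r, n.
(* So [N] contains two points on distinct leaves; their approach gives phi s N inside [N] for all
   [s] of one sign. *)
have [z yz] := exists_off_leaf y.
have [r [n [Nn zE]]] := full z.
have ny : ~ leaf n y.
  by move=> /leaf_sym ny; apply: yz; apply: leaf_trans ny _; rewrite zE; exact: leaf_phi.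
have [c hc happ] := off_leaf_direction ny.
apply/seteqP; split=> // w _; apply: (half_leaf_closed hc cN (x := n)) => s /happ hs.
have [||z0 [_ [/= Nz0 Nsz0]]] := @approaches_limit R K id n n y s
    ((fun p => p.1.1) @^-1` N `&` (fun p => p.1.2) @^-1` N) (@solenoid_compact R) hs.
- apply: closedI; apply: closed_comp => // p _.
  + by apply: (@continuous_comp _ _ _ fst fst); exact: cvg_fst.
  + by apply: (@continuous_comp _ _ _ fst snd); [exact: cvg_fst|exact: cvg_snd].
- by move=> k; split=> /=; exact: iterN.
exact: (minimal_set_semiconj (@phi_continuous R s) (phi_comm s 1) minN cN SN Nz0 Nsz0 Nn).
Qed.

Lemma minimal_set_setT : minimal_set S [set: K].
Proof.
have [|N minN _] := @minimal_set_exists K S setT (@solenoid_compact R).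
  by split=> //; exists (mk (fun=> 0)).
by have NT := minimal_set_full minN; rewrite NT in minN.
Qed.

Lemma orbit_closure_full y : closure (forward_orbit S y) = [set: K].
Proof.
have [N minN sub] := minimal_set_exists (@solenoid_compact R)
  (closure_orbit_invclosed y (@phi_continuous R 1)).
by apply/seteqP; split=> // z _; apply: sub; rewrite (minimal_set_full minN).
Qed.

(** The closure contains the graph of [phi s] for all [s] of one sign, so each of its vertical
    slices contains a half leaf. *)
Lemma off_leaf_orbit_full y y' : ~ leaf y y' ->
  closure (forward_orbit (prod_map S S) (y, y')) = [set: K * K].
Proof.
move=> nl; set W := closure _.
have cS := @phi_continuous R 1.
have [cW _ fW] : invclosed (prod_map S S) W.
  by apply: closure_orbit_invclosed; exact: prod_map_continuous.
have nlS : ~ leaf (S y) (S y') by move=> /leaf_phi2.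
have [c hc happ] := off_leaf_direction nlS.
have Wg s : 0 <= c * s -> forall z, W (z, phi s z).
  move=> /happ hs z.
  have [||z0 [_ /= Wz0]] := @approaches_limit R K id y (S y) (S y') s
    (fst @^-1` W) (@solenoid_compact R) hs.
  - by apply: closed_comp => // p _; exact: cvg_fst.
  - move=> k /=; apply: subset_closure; exists k => //.
    by rewrite iter_prod_map -!iter_phi -!iterSr.
  have cg : continuous (fun w : K => (w, phi s w)).
    by apply: continuous_pair => [w|]; [exact: cvg_id|exact: phi_continuous].
  have gf w : (S w, phi s (S w)) = prod_map S S (w, phi s w).
    by rewrite /prod_map/= (phi_comm s).
  exact: (minimal_set_semiconj cg gf minimal_set_setT cW fW (I : setT z0) Wz0 I).
apply/seteqP; split=> // -[z w] _.
apply: (half_leaf_closed hc (N := [set w | W (z, w)]) (x := z)) => [|s cs].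
  apply: (@closed_comp _ _ (fun w => (z, w)) W) => // p _.
  exact: (@continuous_pair K K K (fun=> z) id (@cst_continuous _ _ _) (fun=> cvg_id)).
exact: Wg.
Qed.

Lemma recurrence (X : dynsys R) (y : K) (x : X) : minimal X ->
  closure (forward_orbit (prod_map S (dynsys_map X)) (y, x)) (y, x).
Proof.
move=> minX; set T : X -> X := dynsys_map X; set f := prod_map S T; set W := closure _.
have cS := @phi_continuous R 1.
have cT : continuous T := @homeo_fun_continuous _ (dynsys_map X).
have [cW W0 fW] : invclosed f W.
  by apply: closure_orbit_invclosed; exact: prod_map_continuous.
have cKX : compact [set: K * X].
  rewrite -setXTT; apply: compact_setX; first exact: solenoid_compact.
  exact: dynsys_compact.
have [M minM MW] := minimal_set_exists cKX (And3 cW W0 fW).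
have [[cM [m0 Mm0] fM] _] := minM.
pose F : homeo (K * X)%type := prod_homeo phi_homeo (dynsys_map X).
(* Minimality of [X] is about two-sided orbits; backward invariance of [M] lets its projection, a
   closed set, contain one and thus be all of [X]. *)
have MV : forall p, M p -> M (homeo_inv F p).
  apply: (minimal_set_preimage (@homeo_funK _ F) (@homeo_invK _ F) _ minM).
  exact: (@homeo_inv_continuous _ F).
have [y' My'] : exists y', M (y', x).
  have cP : closed (snd @` M).
    apply: compact_closed; first exact: metric_hausdorff.
    apply: continuous_compact; last exact: subclosed_compact cM cKX _.
    by apply: continuous_subspaceT => p; exact: cvg_snd.
  have orbP n : (snd @` M) (iterz (dynsys_map X) n m0.2).
    case: n => k /=.
      exists (iter k f m0); last by rewrite iter_prod_map.
      by elim: k => [//|k IH] /=; exact: fM.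
    exists (iter k.+1 (homeo_inv F) m0); last by rewrite iter_prod_map.
    by elim: k.+1 => [//|j IH] /=; exact: MV.
  have P (x1 : X) : (snd @` M) x1.
    apply: contrapT => nP; have oP : open (~` (snd @` M)) by rewrite openC.
    have [|w [nPw [n _ nE]]] := minX m0.2 _ _ oP; first by exists x1.
    by apply: nPw; rewrite -nE.
  by have [[y' x'] /= Mp <-] := P x; exists y'.
have cg s : continuous (prod_map (phi s : K -> K) (@id X)).
  by apply: prod_map_continuous => [|p]; [exact: phi_continuous|exact: cvg_id].
have gf s p : prod_map (phi s) (@id X) (f p) = f (prod_map (phi s) (@id X) p).
  by rewrite /f /prod_map/= (phi_comm s).
have transl s p : M p -> W (prod_map (phi s) id p) -> W (phi s y', x).
  move=> Mp Wp.
  exact: (minimal_set_semiconj (cg s) (gf s) minM cW fW Mp Wp My').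
have [/leafE[s yE]|nl] := pselect (leaf y' y).
  (* Here [W] lies in the image of [M] under [phi s]; any point of [W] then serves as the meeting
     point required by [transl]. *)
  have sub : W `<=` prod_map (phi (- s)) id @^-1` M.
    apply: closure_orbit_min => [|w Mw|].
    - by apply: closed_comp => // p _; exact: cg.
    - by rewrite /= gf; exact: fM.
    - by rewrite /= /prod_map /= yE phiK.
  have [[w1 w2] Ww] := W0; have := transl s _ (sub _ Ww).
  by rewrite /prod_map/= phiNK -yE; apply.
have nlS : ~ leaf (S y) (S y') by move=> /leaf_phi2/leaf_sym.
have [c hc happ] := off_leaf_direction nlS.
(* The approach yields a point over [z] in [W] and one over [phi (- s) z] in [M], so it is the image
   of [M] under [phi s] that meets [W]; hence the opposite sign. *)
have Wy' s : 0 <= - c * s -> W (phi s y', x).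
  rewrite mulNr -mulrN => /happ hs.
  have [||z [x1 [/= Wz Mz]]] := @approaches_limit R X T (T x) (S y) (S y') (- s)
    ((fun p => (p.1.1, p.2)) @^-1` W `&` (fun p => (p.1.2, p.2)) @^-1` M)
    (@dynsys_compact R X) hs.
  - apply: closedI; apply: closed_comp => // p _;
      apply: continuous_pair => {}p; try exact: cvg_snd.
    + by apply: (@continuous_comp _ _ _ fst fst); exact: cvg_fst.
    + by apply: (@continuous_comp _ _ _ fst snd); [exact: cvg_fst|exact: cvg_snd].
  - move=> k; split=> /=.
      apply: subset_closure; exists k => //.
      by rewrite iter_prod_map -!iter_phi -!iterSr.
    rewrite -!iter_phi -!iterSr.
    have -> : (iter k.+1 S y', iter k.+1 T x) = iter k.+1 f (y', x).
      by rewrite iter_prod_map.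
    by elim: k.+1 => [//|j IH] /=; exact: fM.
  apply: transl Mz _; rewrite /prod_map/= -{1}(opprK s) phiK.
  exact: Wz.
apply: (half_leaf_closed (c := - c) (N := [set y | W (y, x)]) (x := y')) => [||s cs].
- by case: hc => ->; [right|left; rewrite opprK].
- apply: (@closed_comp _ _ (fun w => (w, x)) W) => // p _.
  exact: (@continuous_pair K K X id (fun=> x) (fun=> cvg_id) (@cst_continuous _ _ _)).
- exact: Wy'.
Qed.

End SolenoidDynamics.

(** * The solenoid system and its properties *)

Section SolenoidSystem.
Context {R : realType}.
Notation K := (@solenoid R).
Notation S := (phi 1 : K -> K).

Lemma solenoid_nonempty : [set: K] !=set0.
Proof. by exists (mk (fun=> 0)). Qed.

Definition solenoid_system : dynsys R :=
  DynSys phi_homeo solenoid_nonempty (@solenoid_compact R).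

Lemma closure_full_meets (T : topologicalType) (A U : set T) :
  closure A = [set: T] -> open U -> U !=set0 -> U `&` A !=set0.
Proof.
move=> cA oU [u Uu]; have Au : closure A u by rewrite cA.
by have [w [Aw Uw]] := Au U (open_nbhs_nbhs (conj oU Uu)); exists w.
Qed.

Lemma solenoid_minimal : minimal solenoid_system.
Proof.
move=> x U U0 oU.
have [w [Uw [n _ nE]]] := closure_full_meets (orbit_closure_full x) oU U0.
by exists w; split=> //; exists (Posz n.+1).
Qed.

(** A dense orbit of an off-leaf pair enters [U] at a pair that is still off-leaf, whose own forward
    orbit is dense and enters [V]. *)
Lemma solenoid_weakly_mixing : weakly_mixing solenoid_system.
Proof.
move=> U V oU U0 oV V0; pose x : K := mk (fun=> 0).
have [y xy] := exists_off_leaf x.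
have [w [Uw [n _ nE]]] := closure_full_meets (off_leaf_orbit_full xy) oU U0.
have nw : ~ leaf w.1 w.2.
  by rewrite -nE iter_prod_map !iter_phi => /leaf_phi2.
have [v [Vv [m _ mE]]] := closure_full_meets (off_leaf_orbit_full nw) oV V0.
exists (Posz m.+1), v; split=> //; exists w => //.
by rewrite -mE -surjective_pairing.
Qed.

(** The shift s = 0 belongs to both half-lines, so points on distinct leaves are always proximal. *)
Lemma solenoid_not_distal (x : solenoid_system) : ~ distal_point x.
Proof.
move=> dx; have [y xy] := exists_off_leaf (x : K).
have nlS : ~ leaf (S x) (S y) by move=> /leaf_phi2.
have [c _ /(_ 0)] := off_leaf_direction nlS; rewrite mulr0 => /(_ (lexx _)) h0.
have /choice[n_ hn] (k : nat) : exists n : nat,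
    mdist (phi n%:R (S y)) (phi 0 (phi n%:R (S x))) < k.+1%:R^-1.
  by apply: h0; rewrite invr_gt0.
apply: xy; rewrite (dx y); first exact: leaf_refl.
exists (fun k => (n_ k).+1); split=> //; apply/cvgrPdist_lt => e e0.
near=> k; rewrite sub0r normrN ger0_norm ?mdist_ge0//.
rewrite !iterSr !iter_phi metric_sym -(phi0 (phi _ (S x))).
apply: lt_trans (hn k) _; near: k; exact: near_infty_natSinv_lt (PosNum e0).
Unshelve. all: by end_near. Qed.

End SolenoidSystem.

Theorem theorem0p4 (R : realType) :
  exists Y : dynsys R,
    [/\ minimal Y,
        weakly_mixing Y,
        (forall y : Y, ~ distal_point y)
      & forall X : dynsys R, minimal X ->
          forall (y : Y) (x : X),
            recurrent (prod_homeo (dynsys_map Y) (dynsys_map X)) (y, x)].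
Proof.
exists (@solenoid_system R); split.
- exact: solenoid_minimal.
- exact: solenoid_weakly_mixing.
- exact: solenoid_not_distal.
- move=> X minX y x V nV; have [w [[n _ nE] Vw]] := recurrence minX nV.
  by exists n.+1 => //; rewrite [iter _ _ _]nE.
Qed.
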